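(* Let $0\leq\lambda\leq 2m$ and $\max\{0,\lambda-m\}\leq\ell\leq \lfloor\lambda/2\rfloor$. Then $$\dim_k S^\lambda_\ell=\binom{2m}{\lambda}-\binom{2m}{\lambda-2\ell-2}.$$
   Context: Let $k=\mathbf F_q$, $q=2^t$, $m\geq1$. Work in the ring $k[X_1,\dots,X_m,Y_1,\dots,Y_m]/(X_i^2,Y_i^2)_i$ of square-free polynomials; $S^\lambda$ is its degree-$\lambda$ part. Put $W_i=X_iY_i$, and let $Z_i$ denote either $X_i$ or $Y_i$. A square-free homogeneous polynomial $F$ is of class $(\rho,\sigma,\tau,\upsilon)$ if there is a partition of $\{1,\dots,m\}$ into disjoint sets $R=\{r_1,\dots,r_\rho\}$, $R'=\{r'_1,\dots,r'_\rho\}$, $S$, $T$, $U$ with $|S|=\sigma,|T|=\tau,|U|=\upsilon$ such that $F=\prod_{i=1}^{\rho}(W_{r_i}+W_{r'_i})\prod_{i\in S}W_i\prod_{i\in T}Z_i$. $P^\lambda_\ell$ is the set of polynomials of classes $(\rho,\sigma,\tau,\upsilon)$ with $2\rho+2\sigma+\tau=\lambda$ and $\sigma\leq\ell$, and $S^\lambda_\ell$ is the $k$-span of $P^\lambda_\ell$. Convention: $\binom{n}{k}=0$ if $k<0$ or $k>n$. *)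

(* Defs.v *)
From HB Require Import structures.
From mathcomp Require Import all_boot all_order all_algebra all_field.
Set Implicit Arguments. Unset Strict Implicit. Unset Printing Implicit Defensive.
Import GRing.Theory.
Local Open Scope ring_scope.

(* Variables of the ring: (i, false) stands for X_i, (i, true) for Y_i. *)
Definition sfvars (m : nat) := ('I_m * bool)%type.

(* Square-free polynomials k[X_1..X_m,Y_1..Y_m]/(X_i^2,Y_i^2): a polynomial is
   the function giving the coefficient of each square-free monomial, a
   monomial being identified with its set of variables.  The coefficient
   ring is viewed via k^o so that the type is a k-vector space (vectType). *)
Definition sfpoly (k : finFieldType) (m : nat) := {ffun {set sfvars m} -> k^o}.

Section SF.
Variables (k : finFieldType) (m : nat).
Local Notation P := (sfpoly k m).

(* multiplication in the quotient ring: products of monomials sharing a variable vanish *)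
Definition sfmul (f g : P) : P :=
  [ffun M : {set sfvars m} =>
     \sum_(A : {set sfvars m})
       \sum_(B : {set sfvars m} | [disjoint A & B] && (A :|: B == M)) f A * g B].

Definition sfone : P := [ffun M : {set sfvars m} => (M == set0)%:R].

Definition sfvar (v : sfvars m) : P := [ffun M : {set sfvars m} => (M == [set v])%:R].

Definition sfX (i : 'I_m) : P := sfvar (i, false).
Definition sfY (i : 'I_m) : P := sfvar (i, true).
Definition sfW (i : 'I_m) : P := sfmul (sfX i) (sfY i).

(* F is of class (rho, sigma, tau, upsilon): there is a partition of {1..m}
   into R = {r_1..r_rho}, R' = {r'_1..r'_rho} (r, r' injective), S, T, U with
   |S| = sigma, |T| = tau, |U| = upsilon, and a choice Z_i in {X_i, Y_i}
   (z i = false : X_i, z i = true : Y_i) for i in T, such that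
   F = prod_i (W_{r_i} + W_{r'_i}) * prod_{i in S} W_i * prod_{i in T} Z_i. *)
Definition is_class (F : P) (rho sigma tau upsilon : nat) : bool :=
  [exists r : {ffun 'I_rho -> 'I_m}, exists r' : {ffun 'I_rho -> 'I_m},
   exists S : {set 'I_m}, exists T : {set 'I_m}, exists U : {set 'I_m},
   exists z : {ffun 'I_m -> bool},
   [&& injectiveb r, injectiveb r',
       [forall j : 'I_m,
          ((j \in codom r) + (j \in codom r') + (j \in S) + (j \in T) + (j \in U) == 1)%N],
       #|S| == sigma, #|T| == tau, #|U| == upsilon &
       F == sfmul (sfmul (\big[sfmul/sfone]_(i < rho) (sfW (r i) + sfW (r' i)))
                         (\big[sfmul/sfone]_(i in S) sfW i))
                  (\big[sfmul/sfone]_(i in T) sfvar (i, z i))]].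

(* P^lambda_ell: polynomials of some class (rho,sigma,tau,upsilon) with
   2 rho + 2 sigma + tau = lambda and sigma <= ell.  The bounds on the
   (finite) ranges of rho, sigma, tau, upsilon are automatic
   (rho, sigma, tau <= lambda because of the degree equation; upsilon <= m). *)
Definition Pset (lambda ell : nat) : pred P :=
  [pred F | [exists rho : 'I_lambda.+1, exists sigma : 'I_lambda.+1,
             exists tau : 'I_lambda.+1, exists upsilon : 'I_m.+1,
             [&& (2 * rho + 2 * sigma + tau == lambda)%N, (sigma <= ell)%N &
                 is_class F rho sigma tau upsilon]]].

Definition Sspace (lambda ell : nat) : {vspace P} := <<enum (Pset lambda ell)>>%VS.

End SF.

Definition binomz (n : nat) (j : int) : nat :=
  match j with Posz j => 'C(n, j) | Negz _ => 0%N end.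

(* Main.v *)
(* Both sides satisfy the same recursion in the number of index pairs: split a
   polynomial according to its coefficients of 1, X_i, Y_i and W_i for a chosen
   index i; the binomial side follows Pascal's rule applied twice.  For the lower
   bound, a product not involving i is realised as a coefficient of W_i by the
   factor W_i + W_u with an unused index u, or by W_i itself when there is none, in
   which case the degree bound leaves room for one more factor W.  For the upper
   bound, the span is contained in the common kernel of the functionals [ev c] of
   small weight, and this family of kernels is stable under the splitting.  The
   recursion stops at lam = m + ell + 1, where the right-hand side vanishes by
   the symmetry of binomial coefficients and the common kernel is trivial. *)
Require Import Defs.
From HB Require Import structures.
From mathcomp Require Import all_boot all_order all_algebra all_field.
From mathcomp Require Import zify.
Import GRing.Theory.
Local Open Scope ring_scope.

Lemma setUDr_id (T : finType) (A B : {set T}) : B :|: (A :\: B) = B :|: A.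
Proof. by apply/setP=> x; rewrite !inE; case: (x \in B). Qed.

Section Algebra.
Variables (k : finFieldType) (m : nat).
Local Notation P := (sfpoly k m).
Local Notation mul := (@sfmul k m).
Local Notation one := (@sfone k m).
Implicit Types (f g h : P) (A B C M : {set sfvars m}) (J : {set 'I_m}) (i : 'I_m).

(** * Multiplication of square-free polynomials *)

Lemma sfmulE f g M : mul f g M = \sum_(A : {set sfvars m} | A \subset M) f A * g (M :\: A).
Proof.
rewrite ffunE big_mkcond [RHS]big_mkcond; apply: eq_bigr => A _.
case: ifP => [sAM|nsAM].
  rewrite (big_pred1 (M :\: A)) // => B /=; apply/andP/eqP.
    by case=> dAB /eqP <-; rewrite setDUl setDv set0U; apply/esym/setDidPl;
       rewrite disjoint_sym.
  move=> ->; split; first by rewrite -setI_eq0 setIDA setIC setDIl setDv setI0.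
  by rewrite setUDr_id; apply/eqP/setUidPr.
rewrite big_pred0 // => B; apply: contraFF nsAM => /andP[_ /eqP <-].
exact: subsetUl.
Qed.

Lemma sfmulC : commutative mul.
Proof.
move=> f g; apply/ffunP => M; rewrite !ffunE (exchange_big_dep xpredT) //=.
by apply: eq_bigr => A _; apply: eq_big => [B|B _];
   [rewrite disjoint_sym setUC | rewrite mulrC].
Qed.

(** Both sides sum over the splittings of [M] into three disjoint pieces. One side lists them as
    chains [B \subset A \subset M], and the change of index [A :\: B] passes to the other. *)
Lemma sfmulA : associative mul.
Proof.
move=> f g h; apply/ffunP => M; rewrite !sfmulE.
under [RHS]eq_bigr => A _ do rewrite sfmulE mulr_suml.
rewrite [RHS](exchange_big_dep (fun B => B \subset M)) /=; last first.
  by move=> A B sAM sBA; apply: subset_trans sBA sAM.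
apply: eq_bigr => B sBM; rewrite sfmulE mulr_sumr.
rewrite (reindex_onto (fun A => A :\: B) (fun C => B :|: C)) /=; last first.
  move=> C; rewrite subsetD => /andP[_ dCB].
  by rewrite setDUl setDv set0U; apply/setDidPl.
apply: eq_big => [A|A /andP[_ /eqP eA]].
  rewrite setUDr_id; case sBA: (B \subset A); last first.
    by rewrite !andbF; apply/negbTE; rewrite negb_and;
       apply/orP; right; apply: contraFN sBA => /eqP <-; exact: subsetUl.
  rewrite (setUidPr sBA) eqxx !andbT; apply/idP/idP => [sAB|sAM].
    rewrite -(setUidPr sBA) -(setUidPr sBM); apply/subsetP => x.
    rewrite !inE => /orP[-> //|xA]; case xB: (x \in B) => //=.
    by move/subsetP: sAB => /(_ x); rewrite !inE xA xB => /(_ isT).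
  exact: setSD.
by rewrite mulrA setDDl eA.
Qed.

Lemma sfmulDl : left_distributive mul +%R.
Proof.
move=> f g h; apply/ffunP => M; rewrite [RHS]ffunE !sfmulE -big_split.
by apply: eq_bigr => A _; rewrite ffunE mulrDl.
Qed.

(** * Monomials, and coefficients with respect to one index *)

Definition mono B : P := [ffun M => (M == B)%:R].

Lemma sfmul_monoE B f M :
  mul (mono B) f M = if B \subset M then f (M :\: B) else 0.
Proof.
rewrite sfmulE; case: ifP => sBM.
  rewrite (bigD1 B) //= big1 ?addr0 => [|A /andP[_ /negPf nAB]].
    by rewrite ffunE eqxx mul1r.
  by rewrite ffunE nAB mul0r.
rewrite big1 // => A sAM; rewrite ffunE; case: eqP sAM => [->|_ _].
  by rewrite sBM.
by rewrite mul0r.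
Qed.

Lemma sfmul1 : left_id one mul.
Proof.
move=> f; apply/ffunP => M; rewrite -[one]/(mono set0) sfmul_monoE.
by rewrite sub0set setD0.
Qed.

HB.instance Definition _ := Monoid.isComLaw.Build P one mul sfmulA sfmulC sfmul1.

(* A state [q] of the index [i] says which of [X_i] ([q.1]) and [Y_i] ([q.2])
   divide a monomial. *)
Definition svars (i : 'I_m) (q : bool * bool) : {set sfvars m} :=
  [set v | (v.1 == i) && (if v.2 then q.2 else q.1)].

Lemma sfvarE (i : 'I_m) z : sfvar k (i, z) = mono (svars i (~~ z, z)).
Proof.
rewrite /sfvar /mono; suff -> : [set (i, z)] = svars i (~~ z, z) by [].
apply/setP => -[j y]; rewrite !inE /= xpair_eqE.
by case: eqP => //= _; case: y z => [] [].
Qed.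

Lemma sfWE i : sfW k i = mono (svars i (true, true)).
Proof.
rewrite /sfW /sfX /sfY; apply/ffunP => M.
rewrite [sfvar k (i, false)]sfvarE sfmul_monoE !ffunE.
case: ifP => sM.
  congr (_ %:R); congr nat_of_bool; apply/eqP/eqP => e.
    have := congr1 (setU (svars i (~~ false, false))) e.
    rewrite setUDr_id (setUidPr sM) => ->.
    by apply/setP => -[j y]; rewrite !inE /= xpair_eqE; case: eqP; case: y.
  by rewrite e; apply/setP => -[j y]; rewrite !inE /= xpair_eqE; case: eqP; case: y.
case: eqP => // e; case/negP: (negbT sM); rewrite e.
by apply/subsetP => -[j y]; rewrite !inE /=; case: eqP; case: y.
Qed.

(** The value is zero on monomials involving [i], so that the coefficient is a polynomial in the
    variables of the other indices. *)
Definition icoef (i : 'I_m) (q : bool * bool) (f : P) : P :=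
  [ffun A : {set sfvars m} =>
    if [disjoint svars i (true, true) & A] then f (svars i q :|: A) else 0].

Lemma icoef_linear i q : linear (icoef i q).
Proof.
move=> a f g; apply/ffunP => A; rewrite !ffunE.
by case: ifP => _ //; rewrite scaler0 addr0.
Qed.
HB.instance Definition _ i q :=
  GRing.isLinear.Build k P P _ (icoef i q) (icoef_linear i q).

Definition supp (J : {set 'I_m}) f :=
  forall A, f A != 0 -> forall v, v \in A -> v.1 \in J.

Lemma supp_disj J i f A : supp J f -> i \notin J ->
  ~~ [disjoint svars i (true, true) & A] -> f A = 0.
Proof.
move=> sf iJ; apply: contraNeq => /sf sA; rewrite -setI_eq0; apply/eqP/setP => v.
by rewrite !inE if_same andbT; case: eqP => //= vi; apply: contraNF iJ => /sA; rewrite vi.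
Qed.

Lemma svars_sub_disj i q q' A : [disjoint svars i (true, true) & A] ->
  (svars i q' \subset svars i q :|: A) = (q'.1 ==> q.1) && (q'.2 ==> q.2).
Proof.
move=> dA; have nA y : (i, y) \notin A.
  by apply: contraL dA => iA; apply/pred0Pn; exists (i, y); rewrite /= iA !inE eqxx if_same.
apply/subsetP/andP => [sA|[s1 s2] [j y]].
  split; apply/implyP => q1; [have := sA (i, false)|have := sA (i, true)];
  by rewrite !inE eqxx q1 (negPf (nA _)) orbF => /(_ isT).
rewrite !inE /=; case: eqP => //= _.
by case: y => /=; [move/implyP: s2 | move/implyP: s1] => s /s ->.
Qed.

Lemma icoef_mono_same J i q q' f : supp J f -> i \notin J ->
  icoef i q (mul (mono (svars i q')) f) = if q == q' then f else 0.
Proof.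
move=> sf iJ; apply/ffunP => A; rewrite ffunE.
have [dA|ndA] := boolP [disjoint _ & _]; last first.
  by case: eqP; rewrite ?(supp_disj J i f A) // ffunE.
rewrite sfmul_monoE svars_sub_disj //.
case: eqP => [->|/eqP nq].
  rewrite !implybb /= setDUl setDv set0U; congr (f _); apply/setDidPl.
  rewrite disjoint_sym; apply: disjointWl dA; apply/subsetP => v; rewrite !inE.
  by rewrite if_same andbT => /andP[].
rewrite ffunE; case: ifP => // /andP[s1 s2].
apply: (supp_disj J i) => //.
(* Here [q] strictly contains [q'], so a variable of index [i] is left in the argument of [f], where
   [f] vanishes by its support. *)
have [y qy] : exists y : bool, is_true (if y then q.2 && ~~ q'.2 else q.1 && ~~ q'.1).
  by case: q q' nq s1 s2 => [[] []] [[] []] //=; (try by exists true); exists false.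
apply/pred0Pn; exists (i, y); rewrite /= !inE eqxx /=.
by case: y qy => /andP[-> /negPf->].
Qed.

Lemma icoef_supp J i q f : supp J f -> i \notin J ->
  icoef i q f = if q == (false, false) then f else 0.
Proof.
move=> sf iJ; rewrite -(icoef_mono_same J i q (false, false) f) //.
suff -> : svars i (false, false) = set0 by rewrite -[mono set0]/one sfmul1.
by apply/setP=> v; rewrite !inE if_same andbF.
Qed.

Lemma supp_mono J i q f : supp J f -> supp (i |: J) (mul (mono (svars i q)) f).
Proof.
move=> sf A; rewrite sfmul_monoE; case: ifP => [sA|]; last by rewrite eqxx.
move=> /sf sf' v vA; have := sf' v; rewrite !inE vA andbT.
by case: (v.1 == i) => //= ->.
Qed.

Lemma supp_sub (J J' : {set 'I_m}) f : J \subset J' -> supp J f -> supp J' f.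
Proof. by move=> /subsetP sJ sf A /sf sA v /sA /sJ. Qed.

Lemma suppD J f g : supp J f -> supp J g -> supp J (f + g).
Proof.
move=> sf sg A; rewrite ffunE => nz v vA.
have [f0|fn] := eqVneq (f A) 0; last exact: sf fn v vA.
by apply: (sg A) => //; move: nz; rewrite f0 add0r.
Qed.


(** * Functionals given by labels of the indices *)

Definition state (A : {set sfvars m}) (i : 'I_m) : bool * bool :=
  ((i, false) \in A, (i, true) \in A).

(* A label prescribes the state of an index; [None] only asks that it be the
   state of [1] or of [W_i]. *)
Definition allows (a : option (bool * bool)) (q : bool * bool) : bool :=
  if a is Some q' then q == q' else q.1 == q.2.

(** The weight pays for degree not coming from the lone factors [W_i]: a factor [Z_i] survives only
    a label of weight one, and a factor [W_i + W_i'] only if one of its two indices has a label of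
    weight two. *)
Definition wt (a : option (bool * bool)) : nat :=
  if a is Some q then (if q.1 == q.2 then 2 else 1)%N else 0%N.

Definition compat (c : 'I_m -> option (bool * bool)) (J : {set 'I_m})
    (A : {set sfvars m}) : bool :=
  [forall i, if i \in J then allows (c i) (state A i) else state A i == (false, false)].

(* For [f] supported in [J], [ev c J] is a tensor product over [i] in [J] of
   functionals on [<1, X_i, Y_i, W_i>]; on an unlabelled index both [1] and [W_i]
   are sent to [1], so that in characteristic 2 it kills [W_i + W_i'] when [i]
   and [i'] are both unlabelled. *)
Definition ev c J f : k := \sum_(A | compat c J A) f A.

Lemma state_svarsU i q A j : state (svars i q :|: A) j =
  if j == i then (q.1 || (state A i).1, q.2 || (state A i).2) else state A j.
Proof. by rewrite /state !inE /=; case: eqP => [->|]. Qed.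

Lemma state_svarsD i q A j : state (A :\: svars i q) j =
  if j == i then (~~ q.1 && (state A i).1, ~~ q.2 && (state A i).2) else state A j.
Proof. by rewrite /state !inE /=; case: eqP => [->|]. Qed.

Lemma state_inj A B : state A =1 state B -> A = B.
Proof. by move=> e; apply/setP => -[i []]; case: (e i). Qed.

Lemma state_disj A i : [disjoint svars i (true, true) & A] = (state A i == (false, false)).
Proof.
apply/idP/eqP => [dA|[X Y]].
  have nA y : ((i, y) \in A) = false.
    by apply: (disjointFr dA); rewrite !inE eqxx if_same.
  by rewrite /state !nA.
rewrite -setI_eq0; apply/eqP/setP => -[j y]; rewrite !inE if_same andbT /=.
by case: eqP => //= ->; case: y.
Qed.

(** Group the compatible monomials by their state at [i]; removing the variables of [i] from those
    of state [q] leaves the monomials that [ev c J] sees in [icoef i q f]. *)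
Lemma evE_split i J c f : i \notin J ->
  ev c (i |: J) f = \sum_(q | allows (c i) q) ev c J (icoef i q f).
Proof.
move=> iJ; rewrite /ev (partition_big (fun A => state A i) (allows (c i))) /=; last first.
  by move=> A /forallP/(_ i); rewrite !inE eqxx.
apply: eq_bigr => q cq.
rewrite (reindex_onto (fun A => svars i q :|: A) (fun A => A :\: svars i (true, true))) /=;
  last first.
  move=> A /andP[_ /eqP stA]; apply: state_inj => j; rewrite state_svarsU !state_svarsD.
  by rewrite eqxx; case: eqP => // ->; rewrite stA /=; case: (q) => [[] []].
apply: eq_big => [A|A /andP[/andP[okA stA] /eqP eA]]; last first.
  by rewrite ffunE state_disj -eA state_svarsD eqxx eqxx.
apply/andP/idP => [[/andP[okA stA] /eqP eA]|okA].
  apply/forallP => j; have := forallP okA j; rewrite !inE state_svarsU.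
  case: (eqVneq j i) => [-> _|//]; rewrite (negPf iJ) -eA state_svarsD eqxx.
  by [].
have sti : state A i = (false, false).
  by have := forallP okA i; rewrite (negPf iJ) => /eqP.
split; last first.
  apply/eqP/state_inj => j; rewrite state_svarsD !state_svarsU eqxx.
  by case: eqP => // ->; rewrite sti .
rewrite state_svarsU eqxx sti !orbF -surjective_pairing eqxx andbT.
apply/forallP => j; rewrite !inE state_svarsU; have := forallP okA j.
by case: (eqVneq j i) => [-> _|//]; rewrite sti !orbF -surjective_pairing.
Qed.

Lemma eq_ev c c' J f : {in J, c =1 c'} -> ev c J f = ev c' J f.
Proof.
move=> e; apply: eq_bigl => A; apply: eq_forallb => j.
by case: ifP => // jJ; rewrite e.
Qed.

Lemma evD c J f g : ev c J (f + g) = ev c J f + ev c J g.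
Proof. by rewrite /ev -big_split; apply: eq_bigr => A _; rewrite ffunE. Qed.

Lemma evZ c J (a : k) f : ev c J (a *: f) = a * ev c J f.
Proof. by rewrite /ev mulr_sumr; apply: eq_bigr => A _; rewrite ffunE. Qed.

Lemma ev0 c J : ev c J 0 = 0.
Proof. by rewrite /ev big1 // => A _; rewrite ffunE. Qed.

Lemma ev_mono c J i q f : supp J f -> i \notin J ->
  ev c (i |: J) (mul (mono (svars i q)) f) = if allows (c i) q then ev c J f else 0.
Proof.
move=> sf iJ; rewrite evE_split // (bigID (pred1 q)) /= [X in _ + X]big1 => [|q'].
  rewrite addr0; case: ifP => cq.
    rewrite (big_pred1 q) => [|q'] /=; first by rewrite (icoef_mono_same J) ?eqxx.
    by case: eqP => [->|]; rewrite ?cq ?andbF.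
  by rewrite big_pred0 // => q'; case: eqP => [->|]; rewrite ?cq ?andbF.
by case/andP => _ /negPf nq; rewrite (icoef_mono_same J) // nq ev0.
Qed.

Lemma ev_supp c J i f : supp J f -> i \notin J ->
  ev c (i |: J) f = if allows (c i) (false, false) then ev c J f else 0.
Proof.
move=> sf iJ; rewrite -(ev_mono c J i (false, false)) //.
suff -> : svars i (false, false) = set0 by rewrite -[mono set0]/one sfmul1.
by apply/setP=> v; rewrite !inE if_same andbF.
Qed.

(** * Products of the allowed factors, built one factor at a time *)

(* [gen J d s F]: [F] is a product as in [is_class], of degree [d] and with
   [sigma = s], in which [R], [R'], [S] and [T] together cover exactly [J]. *)
Inductive gen : {set 'I_m} -> nat -> nat -> P -> Prop :=
| gen_one : gen set0 0 0 one
| gen_Z i z J d s F : i \notin J -> gen J d s F ->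
    gen (i |: J) d.+1 s (mul (sfvar k (i, z)) F)
| gen_W i J d s F : i \notin J -> gen J d s F ->
    gen (i |: J) d.+2 s.+1 (mul (sfW k i) F)
| gen_R i i' J d s F : i \notin J -> i' \notin J -> i != i' -> gen J d s F ->
    gen (i |: (i' |: J)) d.+2 s (mul (sfW k i + sfW k i') F).

Lemma gen_supp J d s F : gen J d s F -> supp J F.
Proof.
elim=> {J d s F} [|i z J d s F iJ _ IH|i J d s F iJ _ IH|i i' J d s F iJ i'J ii' _ IH].
- by move=> A; rewrite ffunE; case: (eqVneq A set0) => [-> _ v|_]; rewrite ?inE ?eqxx.
- by rewrite sfvarE; apply: supp_mono.
- by rewrite sfWE; apply: supp_mono.
rewrite sfmulDl !sfWE; apply: suppD.
  by apply: supp_mono; apply: supp_sub IH; exact: subsetUr.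
apply: (supp_sub (i' |: J)); [exact: subsetUr|exact: supp_mono].
Qed.

(** A factor [Z_i] has degree one on one index and a factor [W_i + W_i'] degree two on two indices;
    only a lone [W_i] has one degree more than it has indices. *)
Lemma gen_card J d s F : gen J d s F -> (#|J| + s = d)%N.
Proof.
elim=> {J d s F} [|i z J d s F iJ _ <-|i J d s F iJ _ <-|i i' J d s F iJ i'J ii' _ <-].
- by rewrite cards0.
- by rewrite cardsU1 iJ; lia.
- by rewrite cardsU1 iJ; lia.
by rewrite !cardsU1 !inE negb_or iJ i'J ii'; lia.
Qed.

Definition homog d f := forall A, f A != 0 -> #|A| = d.

Lemma card_svars i q : #|svars i q| = (q.1 + q.2)%N.
Proof.
rewrite -sum1_card (eq_bigl (fun v : sfvars m => (v.1 == i) && (if v.2 then q.2 else q.1))).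
  rewrite -(pair_big_dep (pred1 i) (fun _ (b : bool) => if b then q.2 else q.1)
             (fun _ _ => 1%N)) /=.
  by rewrite big_pred1_eq big_mkcond big_bool /=; case: q => [[] []].
by move=> v; rewrite inE.
Qed.

Lemma homog_mono d i (q : bool * bool) f : homog d f ->
  homog (q.1 + q.2 + d)%N (mul (mono (svars i q)) f).
Proof.
move=> hf A; rewrite sfmul_monoE; case: ifP => [sA /hf <-|]; last by rewrite eqxx.
by rewrite -(card_svars i) cardsDS // subnKC // subset_leq_card.
Qed.

Lemma homogD d f g : homog d f -> homog d g -> homog d (f + g).
Proof.
move=> hf hg A; rewrite ffunE => nz; have [f0|fn] := eqVneq (f A) 0; last exact: hf.
by apply: hg; move: nz; rewrite f0 add0r.
Qed.

Lemma gen_homog J d s F : gen J d s F -> homog d F.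
Proof.
elim=> {J d s F} [|i z J d s F iJ _ IH|i J d s F iJ _ IH|i i' J d s F iJ i'J ii' _ IH].
- by move=> A; rewrite ffunE; case: (eqVneq A set0) => [->|_]; rewrite ?cards0 ?eqxx.
- rewrite sfvarE; have /= := homog_mono d i (~~ z, z) F IH.
  by case: z.
- by rewrite sfWE; exact: homog_mono IH.
by rewrite sfmulDl !sfWE; apply: homogD; exact: homog_mono IH.
Qed.

Definition wts (c : 'I_m -> option (bool * bool)) (J : {set 'I_m}) : nat :=
  (\sum_(j in J) wt (c j))%N.

Lemma wtsU1 c i J : i \notin J -> wts c (i |: J) = (wt (c i) + wts c J)%N.
Proof. by move=> iJ; rewrite /wts big_setU1. Qed.

(** Each factor pays for its own degree when the value is nonzero: [Z_i] by a label of weight one,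
    [W_i] by the growth of [2 * s], and [W_i + W_i'] by a label of weight two on [i] or [i']. *)
Lemma gen_ev (ch : 2%N \in [pchar k]) J d s F : gen J d s F ->
  forall c, ev c J F != 0 -> (d <= 2 * s + wts c J)%N.
Proof.
elim=> {J d s F} [//|i z J d s F iJ /gen_supp sF IH|
  i J d s F iJ /gen_supp sF IH|i i' J d s F iJ i'J ii' /gen_supp sF IH] c.
- rewrite sfvarE ev_mono // wtsU1 //.
  case: ifP => [cz /IH le|]; last by rewrite eqxx.
  suff: (0 < wt (c i))%N by lia.
  by case: (c i) cz => [q' /eqP <-|]; case: z.
- rewrite sfWE ev_mono // wtsU1 //.
  by case: ifP => [cz /IH le|]; [lia | rewrite eqxx].
have iJ' : i \notin i' |: J by rewrite !inE negb_or ii'.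
rewrite sfmulDl !sfWE evD ev_mono //; last exact: supp_sub (subsetUr _ _) sF.
rewrite [X in _ + X]ev_supp //; last exact: supp_mono.
rewrite ev_supp // ev_mono // !wtsU1 //.
case: (c i) (c i') => [q|] [q'|] /=;
  do ?case: (eqVneq (_, _)) => //= ?; subst=> //=; rewrite ?addr0 ?add0r ?eqxx // => nz;
  try by [have := IH c nz; lia].
all: try by have := IH c; rewrite ?nz; lia.
(* Both indices are unlabelled: the two terms take the same value and cancel in characteristic 2. *)
by move: nz; rewrite addrr_pchar2 // eqxx.
Qed.

(** * The common kernel of the functionals of small weight *)

(* The shift [e] stands for degree [lam - e] without truncating when [e > lam]. *)
Definition kills (lam e ell : nat) J f : Prop :=
  [/\ supp J f, forall A, f A != 0 -> (#|A| + e = lam)%N &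
      forall c, (wts c J + e + 2 * ell < lam)%N -> ev c J f = 0].

Lemma card_state A : #|A| = (\sum_i ((state A i).1 + (state A i).2))%N.
Proof.
rewrite -sum1_card big_mkcond /=.
transitivity (\sum_(v : sfvars m) ((v.1, v.2) \in A : nat))%N.
  by apply: eq_bigr => -[i y] _; case: (_ \in A).
rewrite -(pair_bigA _ (fun i b => ((i, b) \in A : nat))) /=.
by apply: eq_bigr => i _; rewrite big_bool /= addnC.
Qed.

(* The labelling below lets [ev] single out the coefficient of [A] among the
   monomials of degree [#|A|]: a compatible [B] is contained in [A]. *)
Lemma kills_eq0 lam e ell J f :
  (#|J| + ell + e < lam)%N -> kills lam e ell J f -> f = 0.
Proof.
move=> lt [sf hf ef]; apply/ffunP => A; rewrite [RHS]ffunE.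
have [//|nz] := eqVneq (f A) 0.
have sA j : j \notin J -> state A j = (false, false).
  move=> jJ; rewrite /state; congr (_, _); apply: contraNF jJ; exact: sf A nz (j, _).
pose c j := if state A j == (true, true) then None else Some (state A j).
have cA : compat c J A.
  apply/forallP => j; rewrite /c; case: ifP => [_|/negbT/sA -> //].
  by case: eqP => [->|] //=.
(* At each index of [J] weight and degree add up to two: 2 + 0 for [1], 1 + 1 for [X_i] or [Y_i],
   and 0 + 2 for [W_i], which is left unlabelled. *)
have wc : (wts c J + #|A| = 2 * #|J|)%N.
  rewrite card_state (bigID (mem J)) /= [X in (_ + X)%N]addnC big1 ?add0n; last first.
    by move=> j /sA [-> ->].
  rewrite -big_split /= mulnC -sum_nat_const; apply: eq_bigr => j _.
  by rewrite /c /state; case: (_ \in A); case: (_ \in A).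
have := ef c; rewrite /ev (bigD1 A) //= big1 ?addr0; last first.
  move=> B /andP[cB nBA]; apply: contraNeq nBA => nzB.
  rewrite eqEcard -(leq_add2r e) (hf _ nz) (hf _ nzB) leqnn andbT.
  apply/subsetP => -[j y] yB; have /= jJ := sf B nzB _ yB.
  have := forallP cB j; rewrite jJ /c => {jJ}; move: yB.
  rewrite /state; case: eqP => [[X Y] _ _|_ yB /eqP [X Y]]; first by case: y.
  by move: yB; case: y; rewrite ?X ?Y.
(* Since [#|A| + e = lam], the weight condition on [c] is twice the inequality
   [#|J| + ell + e < lam]. *)
apply; have := hf _ nz; lia.
Qed.

Lemma card_svarsU i q A : [disjoint svars i (true, true) & A] ->
  #|svars i q :|: A| = (q.1 + q.2 + #|A|)%N.
Proof.
move=> dA; rewrite cardsU card_svars; suff -> : svars i q :&: A = set0 by rewrite cards0 subn0.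
apply/eqP; rewrite setI_eq0; apply: disjointWl dA; apply/subsetP => v.
by rewrite !inE if_same andbT => /andP[].
Qed.

(** Extend a labelling of [J] by the label [q] at [i]; its weight is the rise in the shift. For [q]
    the state of [1] this label would cost two, so [i] stays unlabelled instead; the functional then
    also sees the coefficient of [W_i], which therefore has to vanish beforehand. *)
Lemma kills_icoef lam e ell J i (q : bool * bool) f : i \notin J ->
  (q == (false, false) -> icoef i (true, true) f = 0) ->
  kills lam e ell (i |: J) f -> kills lam (e + q.1 + q.2) ell J (icoef i q f).
Proof.
move=> iJ q0 [sf hf ef]; split.
- move=> A; rewrite ffunE; case: ifP => [dA nz v vA|]; last by rewrite eqxx.
  have := sf _ nz v; rewrite !inE vA orbT => /(_ isT) /orP[/eqP vi|//].
  by have := disjointFl dA vA; rewrite !inE vi eqxx if_same.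
- move=> A; rewrite ffunE; case: ifP => [dA /hf|]; last by rewrite eqxx.
  by rewrite card_svarsU //; lia.
move=> c lt.
pose c' j := if j == i then (if q == (false, false) then None else Some q) else c j.
have cc : {in J, c' =1 c}.
  by move=> j jJ; rewrite /c'; case: eqP jJ => // ->; rewrite (negPf iJ).
have wc : wts c' J = wts c J by apply: eq_bigr => j /cc ->.
have := ef c'; rewrite wtsU1 // wc evE_split // {1 2}/c' eqxx.
case: ifP => [q00|qn0].
  rewrite (bigD1 q) ?(eqP q00) //= (big_pred1 (true, true)); last first.
    by move=> [[] []].
  rewrite q0 // ev0 addr0 (eq_ev _ c) //; apply.
  by move: lt; rewrite (eqP q00) /=; lia.
rewrite (big_pred1 q) // (eq_ev _ c) //; apply.
by move: lt qn0; case: (q) => [[] []] //=; lia.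
Qed.

(** * The binomial recursion *)

(** The test makes the coefficient zero when the lower index is negative; truncated subtraction
    alone would give ['C(n, 0)], which is 1. *)
Definition binsub n lam e : nat := if (e <= lam)%N then 'C(n, lam - e) else 0%N.

Lemma binsubS n lam e : binsub n.+1 lam e = (binsub n lam e + binsub n lam e.+1)%N.
Proof.
rewrite /binsub; have [lt|le] := ltnP e lam.
  by rewrite (ltnW lt) subnS -[in LHS](@prednK (lam - e)) ?subn_gt0 // binS prednK ?subn_gt0.
by case: leqP => // le'; rewrite addn0 (_ : lam - e = 0)%N ?bin0 //; lia.
Qed.

(** The two lower indices add up to [2 * n]. If one of them is negative, the other exceeds [2 * n]
    and both coefficients vanish. *)
Lemma binsub_sym n lam e ell : lam = (n + ell + e).+1 ->
  binsub (2 * n) lam (e + 2 * ell + 2) = binsub (2 * n) lam e.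
Proof.
move=> ->; rewrite /binsub; case: leqP => le.
  have -> : (e <= (n + ell + e).+1)%N by lia.
  rewrite -[RHS]bin_sub; last lia.
  congr 'C(_, _); lia.
by case: leqP => // _; rewrite bin_small //; lia.
Qed.

Lemma icoef_eq0 i f : (forall q, icoef i q f = 0) -> f = 0.
Proof.
move=> pf; apply/ffunP => A; rewrite [RHS]ffunE.
have := congr1 (fun g : P => g (A :\: svars i (true, true))) (pf (state A i)).
rewrite !ffunE state_disj state_svarsD !eqxx /=.
suff -> : svars i (state A i) :|: A :\: svars i (true, true) = A by [].
apply: state_inj => j; rewrite state_svarsU !state_svarsD eqxx.
by case: eqP => // ->; case: (state A i) => [[] []].
Qed.

(** * The upper bound for the dimension *)

(** Induction on the number of indices, by rank-nullity for the four coefficient maps at one index.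
    The range of [lam] includes the value [n + ell + e + 1], where both sides are known, so that
    every other value stays in range when [n] drops by one. *)
Lemma kills_dim (n : nat) J lam e ell (U : {vspace P}) :
  #|J| = n -> (lam <= (n + ell + e).+1)%N ->
  (forall f, f \in U -> kills lam e ell J f) ->
  (\dim U + binsub (2 * n) lam (e + 2 * ell + 2) <= binsub (2 * n) lam e)%N.
Proof.
elim: n J lam e U => [|n IH] J lam e U cJ; rewrite leq_eqVlt => /orP[/eqP lamE|lt] KU.
- have -> : U = 0%VS.
    by apply/eqP; rewrite -subv0; apply/subvP => f /KU /kills_eq0 ->; rewrite ?mem0v //; lia.
  by rewrite dimv0 add0n binsub_sym.
(* Now [lam <= ell + e], so the lower index is negative. With [J] empty only constants remain. *)
- have -> : binsub (2 * 0) lam (e + 2 * ell + 2) = 0%N by rewrite /binsub; case: leqP; lia.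
  rewrite addn0 /binsub bin0n.
  have J0 : J = set0 by apply/eqP; rewrite -cards_eq0 cJ.
  have f0 f A : f \in U -> A != set0 -> f A = 0.
    case/KU => sf _ _; apply: contraNeq => /sf sA; rewrite -subset0.
    by apply/subsetP => v /sA; rewrite J0 inE.
  case: (eqVneq e lam) => [->|ne].
    rewrite leqnn subnn eqxx.
    have : (U <= <[one]>)%VS.
      apply/subvP => f fU; apply/vlineP; exists (f set0); apply/ffunP => A.
      rewrite !ffunE; case: eqP => [->|/eqP nA].
        by rewrite -[_ *: _]/(_ * _) mulr1.
      by rewrite scaler0 f0.
    by move/dimvS/leq_trans; apply; rewrite dim_vline; case: eqP.
  have -> : U = 0%VS.
    apply/eqP; rewrite -subv0; apply/subvP => f fU; rewrite memv0; apply/eqP/ffunP => A.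
    rewrite [RHS]ffunE; have [->|nA] := eqVneq A set0; last exact: f0.
    case/KU: fU => _ hf _; apply/eqP; apply: contraNT ne => /hf <-.
    by rewrite cards0.
  by rewrite dimv0.
- have -> : U = 0%VS.
    by apply/eqP; rewrite -subv0; apply/subvP => f /KU /kills_eq0 ->; rewrite ?mem0v //; lia.
  by rewrite dimv0 add0n binsub_sym.
have [i iJ] : exists i, i \in J by apply/set0Pn; rewrite -card_gt0 cJ.
pose J' := J :\ i.
have iJ' : i \notin J' by rewrite !inE eqxx.
have cJ' : #|J'| = n by move: cJ; rewrite (cardsD1 i) iJ => -[].
have JE : i |: J' = J by rewrite setD1K.
pose L q : 'End(P) := linfun (icoef i q).
(* The coefficient of [W_i] is removed first, since [kills_icoef] treats the coefficient of [1] only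
   where that of [W_i] vanishes. *)
pose U1 := (U :&: lker (L (true, true)))%VS.
pose U2 := (U1 :&: lker (L (true, false)))%VS.
pose U3 := (U2 :&: lker (L (false, true)))%VS.
pose U4 := (U3 :&: lker (L (false, false)))%VS.
have U1U : (U1 <= U)%VS := capvSl _ _.
have U2U : (U2 <= U)%VS := subv_trans (capvSl _ _) U1U.
have U3U : (U3 <= U)%VS := subv_trans (capvSl _ _) U2U.
have bound (V : {vspace P}) (q : bool * bool) : (V <= U)%VS ->
    (q == (false, false) -> (V <= lker (L (true, true)))%VS) ->
    (\dim (L q @: V) + binsub (2 * n) lam (e + q.1 + q.2 + 2 * ell + 2) <=
       binsub (2 * n) lam (e + q.1 + q.2))%N.
  move=> VU q0; apply: (IH J') => //.
    by rewrite !addSn ltnS in lt; apply: leq_trans lt _; rewrite ltnS leq_add2l -addnA leq_addr.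
  move=> _ /memv_imgP[f fV ->]; rewrite lfunE /=; apply: kills_icoef => //.
    by move=> /q0/subvP/(_ f fV); rewrite memv_ker lfunE => /eqP.
  by rewrite JE; apply: KU; exact: (subvP VU).
have := bound U (true, true) (subvv _) (fun q0 => ltac:(by [])).
have := bound U1 (true, false) U1U (fun q0 => ltac:(by [])).
have := bound U2 (false, true) U2U (fun q0 => ltac:(by [])).
have := bound U3 (false, false) U3U (fun _ => subv_trans (capvSl _ _)
   (subv_trans (capvSl _ _) (capvSr _ _))).
have U40 : U4 = 0%VS.
  apply/eqP; rewrite -subv0; apply/subvP => f.
  rewrite !memv_cap !memv_ker !lfunE /= => /andP[/andP[/andP[/andP[_ p1] p2] p3] p4].
  rewrite memv0; apply/eqP/(icoef_eq0 i) => -[[] []]; exact/eqP.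
have := limg_ker_dim (L (true, true)) U.
have := limg_ker_dim (L (true, false)) U1.
have := limg_ker_dim (L (false, true)) U2.
have := limg_ker_dim (L (false, false)) U3.
rewrite -/U1 -/U2 -/U3 -/U4 U40 dimv0 /= !addn0 !addn1.
(* Pascal's rule, applied twice, splits both binomials into terms of shift [e], [e + 1] (twice) and
   [e + 2], one for each coefficient map. *)
rewrite mulnS !add2n !binsubS !(addSn, addnS).
have arith (u u1 u2 u3 d0 d1 d2 d3 x0 x1 x2 y0 y1 y2 : nat) :
  (0 + d0 = u3 -> u3 + d1 = u2 -> u2 + d2 = u1 -> u1 + d3 = u ->
   d0 + y0 <= x0 -> d1 + y1 <= x1 -> d2 + y1 <= x1 -> d3 + y2 <= x2 ->
   u + (y0 + y1 + (y1 + y2)) <= x0 + x1 + (x1 + x2))%N.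
  clear; lia.
exact: arith.
Qed.

(** * The lower bound for the dimension *)

(** The same filtration is used, and each image contains the products on one index fewer. The space
    [U] is any space containing the products, not just their span, so that the induction applies to
    these images. *)
Lemma gen_dim (n : nat) J lam e ell (U : {vspace P}) :
  #|J| = n -> (lam <= (n + ell + e).+1)%N ->
  (forall J0 d s F, J0 \subset J -> gen J0 d s F -> (s <= ell)%N -> (d + e = lam)%N ->
     F \in U) ->
  (binsub (2 * n) lam e <= \dim U + binsub (2 * n) lam (e + 2 * ell + 2))%N.
Proof.
elim: n J lam e U => [|n IH] J lam e U cJ; rewrite leq_eqVlt => /orP[/eqP lamE|lt] gU.
- by rewrite binsub_sym // leq_addl.
- rewrite [X in (X <= _)%N]/binsub bin0n; case: (leqP e lam) => // le.
  case: (eqVneq (lam - e)%N 0%N) => // lam0.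
  have : one \in U by apply: (gU set0 0%N 0%N) => //; [exact: sub0set | exact: gen_one | lia].
  rewrite memvE => /dimvS; rewrite dim_vline.
  suff -> : one != 0 by move=> /leq_trans; apply; exact: leq_addr.
  apply/eqP => /ffunP/(_ set0); rewrite !ffunE eqxx => /eqP; exact/negP/oner_neq0.
- by rewrite binsub_sym // leq_addl.
have [i iJ] : exists i, i \in J by apply/set0Pn; rewrite -card_gt0 cJ.
pose J' := J :\ i.
have iJ' : i \notin J' by rewrite !inE eqxx.
have cJ' : #|J'| = n by move: cJ; rewrite (cardsD1 i) iJ => -[].
have sub1 J0 : J0 \subset J' -> i |: J0 \subset J.
  by move=> s0; rewrite -(setD1K iJ) setUS.
pose L q : 'End(P) := linfun (icoef i q).
pose U1 := (U :&: lker (L (true, true)))%VS.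
pose U2 := (U1 :&: lker (L (true, false)))%VS.
pose U3 := (U2 :&: lker (L (false, true)))%VS.
have bound (V : {vspace P}) (q : bool * bool) :
    (forall J0 d s F, J0 \subset J' -> gen J0 d s F -> (s <= ell)%N ->
      (d + (e + q.1 + q.2) = lam)%N -> F \in (L q @: V)%VS) ->
    (binsub (2 * n) lam (e + q.1 + q.2) <=
       \dim (L q @: V) + binsub (2 * n) lam (e + q.1 + q.2 + 2 * ell + 2))%N.
  apply: IH => //.
  by rewrite !addSn ltnS in lt; apply: leq_trans lt _; rewrite ltnS leq_add2l -addnA leq_addr.
have inL (V : {vspace P}) q G F : G \in V -> icoef i q G = F -> F \in (L q @: V)%VS.
  by move=> GV <-; apply/memv_imgP; exists G => //; rewrite lfunE.
have notin J0 : J0 \subset J' -> i \notin J0.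
  by move=> s0; apply: contra iJ' => /(subsetP s0).
have singleU J0 d s F y : J0 \subset J' -> gen J0 d s F -> (s <= ell)%N ->
    (d + e.+1 = lam)%N ->
    mul (mono (svars i (~~ y, y))) F \in U /\
    forall q, icoef i q (mul (mono (svars i (~~ y, y))) F) = if q == (~~ y, y) then F else 0.
  move=> s0 gF sl de; split.
    rewrite -sfvarE; apply: gU (sub1 _ s0) (gen_Z _ _ _ _ _ _ (notin _ s0) gF) sl _.
    by rewrite addSnnS.
  by move=> q; apply: (icoef_mono_same J0); [exact: gen_supp gF | exact: notin].
have bd0 : (binsub (2 * n) lam e <=
    \dim (L (false, false) @: U3) + binsub (2 * n) lam (e + 2 * ell + 2))%N.
  have := bound U3 (false, false); rewrite /= !(addn0, addn1); apply.
  move=> J0 d s F s0 gF sl de.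
  have pF q : icoef i q F = if q == (false, false) then F else 0.
    by apply: (icoef_supp J0); [exact: gen_supp gF | exact: notin].
  apply: (inL _ _ F); last by rewrite pF.
  rewrite !memv_cap !memv_ker !lfunE /= !pF /= eqxx !andbT.
  exact: gU (subset_trans s0 (subsetDl _ _)) gF sl de.
have bd1 : (binsub (2 * n) lam e.+1 <=
    \dim (L (false, true) @: U2) + binsub (2 * n) lam (e.+1 + 2 * ell + 2))%N.
  have := bound U2 (false, true); rewrite /= !(addn0, addn1); apply.
  move=> J0 d s F s0 gF sl de.
  have [GU pG] := singleU _ _ _ _ true s0 gF sl de.
  apply: (inL _ _ (mul (mono (svars i (~~ true, true))) F)); last by rewrite pG.
  by rewrite !memv_cap !memv_ker !lfunE /= !pG /= eqxx !andbT.
have bd2 : (binsub (2 * n) lam e.+1 <=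
    \dim (L (true, false) @: U1) + binsub (2 * n) lam (e.+1 + 2 * ell + 2))%N.
  have := bound U1 (true, false); rewrite /= !(addn0, addn1); apply.
  move=> J0 d s F s0 gF sl de.
  have [GU pG] := singleU _ _ _ _ false s0 gF sl de.
  apply: (inL _ _ (mul (mono (svars i (~~ false, false))) F)); last by rewrite pG.
  by rewrite !memv_cap !memv_ker !lfunE /= !pG /= eqxx !andbT.
have bd3 : (binsub (2 * n) lam e.+2 <=
    \dim (L (true, true) @: U) + binsub (2 * n) lam (e.+2 + 2 * ell + 2))%N.
  have := bound U (true, true); rewrite /= !(addn0, addn1); apply.
  move=> J0 d s F s0 gF sl de.
  have sF := gen_supp _ _ _ _ gF; have iJ0 := notin _ s0.
  have pW : icoef i (true, true) (mul (sfW k i) F) = F.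
    by rewrite sfWE (icoef_mono_same J0).
  (* If [J0] is all of [J'], then [d = n + s] by [gen_card], and the bound on [lam] gives [s < ell]:
     one more factor [W_i] is allowed. *)
  have [sJ|/subsetPn[u uJ' uJ0]] := boolP (J' \subset J0).
    apply: (inL _ _ (mul (sfW k i) F)) => //.
    apply: gU (sub1 _ s0) (gen_W _ _ _ _ _ iJ0 gF) _ _; last by lia.
    have E : J0 = J' by apply/eqP; rewrite eqEsubset s0.
    by have := gen_card _ _ _ _ gF; rewrite E cJ'; lia.
  have iu : i != u by apply: contraNneq iJ' => ->.
  have iuJ0 : i \notin u |: J0 by rewrite !inE negb_or iu.
  (* The term [W_u F] is free of [i] and so affects only the coefficient of [1], on which membership
     in [U] puts no condition. *)
  apply: (inL _ _ (mul (sfW k i + sfW k u) F)).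
    apply: gU (gen_R _ _ _ _ _ _ iJ0 uJ0 iu gF) sl _; last by lia.
    by rewrite sub1 // subUset sub1set uJ'.
  rewrite sfmulDl linearD /= pW [X in _ + X](icoef_supp (u |: J0)) ?addr0 //.
  by rewrite sfWE; apply: supp_mono.
have := limg_ker_dim (L (true, true)) U.
have := limg_ker_dim (L (true, false)) U1.
have := limg_ker_dim (L (false, true)) U2.
have := limg_ker_dim (L (false, false)) U3.
rewrite -/U1 -/U2 -/U3 /= => e0 e1 e2 e3.
rewrite mulnS !add2n !binsubS !(addSn, addnS).
have arith (u u1 u2 u3 u4 d0 d1 d2 d3 x0 x1 x2 y0 y1 y2 : nat) :
  (u4 + d0 = u3 -> u3 + d1 = u2 -> u2 + d2 = u1 -> u1 + d3 = u ->
   x0 <= d0 + y0 -> x1 <= d1 + y1 -> x1 <= d2 + y1 -> x2 <= d3 + y2 ->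
   x0 + x1 + (x1 + x2) <= u + (y0 + y1 + (y1 + y2)))%N.
  clear; lia.
move: bd0 bd1 bd2 bd3; rewrite !(addSn, addnS); exact: arith e0 e1 e2 e3.
Qed.

(** * The span lies in the common kernel *)

Lemma wts_sub c J J' : J \subset J' -> (wts c J <= wts c J')%N.
Proof.
by move=> sJ; rewrite /wts [leqRHS](big_setID J) /= (setIidPr sJ) leq_addr.
Qed.

(** At indices outside [J] every monomial of [f] has the state of [1]. A label there either allows
    it, and changes nothing, or makes the whole value zero. *)
Lemma ev_widen c J J' f : supp J f -> J \subset J' ->
  ev c J' f != 0 -> ev c J f != 0.
Proof.
move=> sf /subsetP sJ nz.
have st0 A j : f A != 0 -> j \notin J -> state A j = (false, false).
  by move=> /sf sA jJ; rewrite /state; congr (_, _); apply: contraNF jJ => /sA.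
have c0 j : j \in J' -> j \notin J -> allows (c j) (false, false).
  move=> jJ' jJ; apply: contraNT nz => nc; apply/eqP/big1 => A okA.
  have := forallP okA j; rewrite jJ' => cA; apply/eqP; apply: contraNT nc => nzA.
  by rewrite -(st0 A j).
suff <- : ev c J' f = ev c J f by [].
rewrite /ev big_mkcond [RHS]big_mkcond; apply: eq_bigr => A _.
have [->|nzA] := eqVneq (f A) 0; first by rewrite !if_same.
congr (if _ then _ else _); apply: eq_forallb => j.
case jJ: (j \in J); first by rewrite sJ.
by rewrite st0 ?jJ //; case: ifP => // jJ'; rewrite c0 ?jJ.
Qed.

Lemma gen_kills (ch : 2%N \in [pchar k]) ell J J' d s F :
  J \subset J' -> gen J d s F -> (s <= ell)%N -> kills d 0 ell J' F.
Proof.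
move=> sJ gF sl; split.
- exact: supp_sub sJ (gen_supp _ _ _ _ gF).
- by move=> A nz; rewrite addn0; exact: gen_homog gF A nz.
move=> c lt; apply: contraTeq lt => /(ev_widen _ J _ _ (gen_supp _ _ _ _ gF) sJ).
move=> /(gen_ev ch _ _ _ _ gF) le; have := wts_sub c J J' sJ.
by rewrite -leqNgt; lia.
Qed.

Lemma kills_lin lam e ell J (a : k) f g :
  kills lam e ell J f -> kills lam e ell J g -> kills lam e ell J (a *: f + g).
Proof.
have nzD A : (a *: f + g) A != 0 -> f A != 0 \/ g A != 0.
  rewrite !ffunE => nz; have [f0|fn] := eqVneq (f A) 0; last by left.
  by right; apply: contraNneq nz => ->; rewrite f0 scaler0 addr0.
move=> [sf hf ef] [sg hg eg]; split.
- by move=> A /nzD[/sf|/sg].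
- by move=> A /nzD[/hf|/hg].
by move=> c lt; rewrite evD evZ ef // eg // mulr0 addr0.
Qed.

Lemma kills_span lam e ell J (X : seq P) :
  (forall f, f \in X -> kills lam e ell J f) ->
  forall f, f \in <<X>>%VS -> kills lam e ell J f.
Proof.
move=> KX f /(@coord_span _ _ _ (in_tuple X)) ->.
have K0 : kills lam e ell J 0.
  split=> [A|A|c _]; rewrite ?ev0 //; by rewrite ffunE eqxx.
apply: big_ind => // [g h Kg Kh|i _]; first by rewrite -[g]scale1r; exact: kills_lin.
by rewrite -[X in kills _ _ _ _ X]addr0; apply: kills_lin => //; apply/KX/mem_nth/ltn_ord.
Qed.

(** * Agreement of the inductive products with [Pset] *)

Lemma gen_prodZ (z : 'I_m -> bool) (l : seq 'I_m) J d s F :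
  uniq l -> {in l, forall i, i \notin J} -> gen J d s F ->
  gen ([set i in l] :|: J) (size l + d) s
      (mul (\big[mul/one]_(i <- l) sfvar k (i, z i)) F).
Proof.
move=> ul lJ gF; elim: l ul lJ => [|i l IH] /= => [_ _|/andP[il ul] lJ].
  by rewrite big_nil sfmul1 set_nil set0U.
rewrite big_cons -sfmulA set_cons -setUA addSn; apply: gen_Z.
  by rewrite !inE negb_or il lJ ?inE ?eqxx.
by apply: IH => // j jl; rewrite lJ // inE jl orbT.
Qed.

Lemma gen_prodW (l : seq 'I_m) J d s F :
  uniq l -> {in l, forall i, i \notin J} -> gen J d s F ->
  gen ([set i in l] :|: J) (2 * size l + d) (size l + s)
      (mul (\big[mul/one]_(i <- l) sfW k i) F).
Proof.
move=> ul lJ gF; elim: l ul lJ => [|i l IH] /= => [_ _|/andP[il ul] lJ].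
  by rewrite big_nil sfmul1 set_nil set0U.
rewrite big_cons -sfmulA set_cons -setUA mulnS !addSn add0n; apply: gen_W.
  by rewrite !inE negb_or il lJ ?inE ?eqxx.
by apply: IH => // j jl; rewrite lJ // inE jl orbT.
Qed.

(** The covered set is only bounded from above, which is enough to see that the next pair of indices
    is new. *)
Lemma gen_prodR (I : eqType) (r r' : I -> 'I_m) (l : seq I) J d s F :
  uniq (map r l) -> uniq (map r' l) ->
  (forall x x', x \in l -> x' \in l -> r x != r' x') ->
  {in l, forall x, r x \notin J} -> {in l, forall x, r' x \notin J} -> gen J d s F ->
  exists J', gen J' (2 * size l + d) s
      (mul (\big[mul/one]_(i <- l) (sfW k (r i) + sfW k (r' i))) F) /\
    forall j, j \in J' -> [|| j \in map r l, j \in map r' l | j \in J].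
Proof.
move=> ul ul' rr' lJ lJ' gF.
elim: l ul ul' rr' lJ lJ' => [|i l IH] /= => [_ _ _ _ _|].
  by exists J; split=> //; rewrite big_nil sfmul1.
case/andP=> il ul /andP[il' ul'] rr' lJ lJ'.
have il0 : i \in i :: l by rewrite inE eqxx.
have sl j : j \in l -> j \in i :: l by move=> jl; rewrite inE jl orbT.
have [|||||J1 [g1 J1P]] := IH => //.
- by move=> j j' /sl jl /sl; exact: rr'.
- by move=> j /sl /lJ.
- by move=> j /sl /lJ'.
exists (r i |: (r' i |: J1)); split.
  rewrite big_cons -sfmulA mulnS !addSn add0n; apply: gen_R => //; last exact: rr'.
    apply/negP => /J1P; rewrite (negPf il) (negPf (lJ i il0)) orbF /=.
    by case/mapP=> j jl /eqP; rewrite (negPf (rr' _ _ il0 (sl _ jl))).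
  apply/negP => /J1P; rewrite (negPf il') (negPf (lJ' i il0)) !orbF.
  by case/mapP=> j jl /eqP; rewrite eq_sym (negPf (rr' _ _ (sl _ jl) il0)).
move=> j; rewrite !inE => /or3P[->|->|/J1P /or3P[]->]; by rewrite ?orbT.
Qed.

Lemma Pset_gen lam ell F : @Pset k m lam ell F ->
  exists J s, gen J lam s F /\ (s <= ell)%N.
Proof.
case/existsP=> rho /existsP[sigma /existsP[tau /existsP[ups /and3P[/eqP degE sl]]]].
case/existsP=> r /existsP[r' /existsP[S /existsP[T /existsP[U /existsP[z]]]]].
case/and5P=> /injectiveP ri /injectiveP r'i /forallP part cS /and3P[cT _ /eqP ->].
have p1 j : ((j \in codom r) + (j \in codom r') + (j \in S) + (j \in T) <= 1)%N.
  by rewrite -(eqP (part j)) leq_addr.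
(* The product is built from the inside, first over [T], then [S], then the pairs; [p1] supplies the
   disjointness at each stage. *)
have gT := gen_prodZ z (enum T) set0 0 0 one (enum_uniq _)
  (fun i _ => negbT (in_set0 i)) gen_one.
have inT j : (j \in [set i in enum T] :|: set0) = (j \in T).
  by rewrite !inE orbF mem_enum.
have ST : {in enum S, forall i, i \notin [set i in enum T] :|: set0}.
  by move=> j; rewrite mem_enum inT => jS; have := p1 j; rewrite jS; case: (j \in T); lia.
have gS := gen_prodW (enum S) _ _ _ _ (enum_uniq _) ST gT.
have inST j : j \in [set i in enum S] :|: ([set i in enum T] :|: set0) = (j \in S) || (j \in T).
  by rewrite in_setU inT inE mem_enum.
have [|||||J [gR _]] := gen_prodR _ r r' (index_enum 'I_rho) _ _ _ _ _ _ _ _ _ gS.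
- by rewrite map_inj_uniq ?index_enum_uniq.
- by rewrite map_inj_uniq ?index_enum_uniq.
- move=> i i' _ _; apply/eqP => e; have := p1 (r i).
  by rewrite codom_f e codom_f; lia.
- by move=> i _; have := p1 (r i); rewrite inST codom_f; lia.
- by move=> i _; have := p1 (r' i); rewrite inST codom_f; lia.
exists J, sigma; split => //; move: gR.
rewrite !big_enum /= -!sfmulA [mul _ one]sfmulC sfmul1 -!cardE (eqP cS) (eqP cT).
have -> : size (index_enum 'I_rho) = rho by rewrite -sum1_size sum1_card card_ord.
by rewrite !addn0 addnA degE.
Qed.

(** A list of pairs replaces the functions [r] and [r'], so that adding a factor [W_i + W_i'] is a
    cons. *)
Definition class_form (rs : seq ('I_m * 'I_m)) (S T : {set 'I_m}) (z : 'I_m -> bool) : P :=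
  mul (mul (\big[mul/one]_(p <- rs) (sfW k p.1 + sfW k p.2)) (\big[mul/one]_(i in S) sfW k i))
      (\big[mul/one]_(i in T) sfvar k (i, z i)).

(** The counting equation says at once that the entries of [rs] are distinct, that they avoid [S]
    and [T], that [S] and [T] are disjoint, and that together these cover [J]; in this form it
    passes easily through each induction step. *)
Lemma gen_class J d s F : gen J d s F ->
  exists rs (S T : {set 'I_m}) z,
  [/\ forall j, (count_mem j (map fst rs) + count_mem j (map snd rs) +
        (j \in S) + (j \in T))%N = (j \in J),
     #|S| = s, (2 * size rs + 2 * s + #|T|)%N = d & F = class_form rs S T z].
Proof.
elim=> {J d s F} [|i y J d s F iJ _ [rs [S [T [z [cJ cS <- ->]]]]]
  |i J d s F iJ _ [rs [S [T [z [cJ cS <- ->]]]]]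
  |i i' J d s F iJ i'J ii' _ [rs [S [T [z [cJ cS <- ->]]]]]].
- exists [::], set0, set0, (fun=> false); split; rewrite ?cards0 //.
    by move=> j; rewrite !inE.
  by rewrite /class_form big_nil !big_set0 !sfmul1.
- have := cJ i; rewrite (negPf iJ) => ci.
  have iT : i \notin T by case: (i \in T) ci; lia.
  exists rs, S, (i |: T), (fun j => if j == i then y else z j); split=> //.
  + move=> j; have := cJ j; rewrite !inE; case: (eqVneq j i) => [->|_] //=.
    by rewrite (negPf iJ) (negPf iT); lia.
  + by rewrite cardsU1 iT; lia.
  rewrite /class_form big_setU1 //= eqxx.
  rewrite [RHS]sfmulA [mul _ (sfvar _ _)]sfmulC -[RHS]sfmulA; congr (mul _ (mul _ _)).
  apply: eq_bigr => j jT; case: eqP => // ji; by rewrite -ji jT in iT.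
- have := cJ i; rewrite (negPf iJ) => ci.
  have iS : i \notin S by case: (i \in S) ci; lia.
  exists rs, (i |: S), T, z; split=> //.
  + move=> j; have := cJ j; rewrite !inE; case: (eqVneq j i) => [->|_] //=.
    by rewrite (negPf iJ) (negPf iS); lia.
  + by rewrite cardsU1 iS cS.
  + lia.
  rewrite /class_form big_setU1 //= sfmulA; congr (mul _ _).
  rewrite [RHS]sfmulA [mul _ (sfW _ _)]sfmulC -[RHS]sfmulA; congr (mul _ _).
exists ((i, i') :: rs), S, T, z; split=> //.
- move=> j; rewrite !inE /= [i == j]eq_sym [i' == j]eq_sym; have := cJ j.
  case: (eqVneq j i) => [->|_] /=; first by rewrite (negPf iJ) (negPf ii') /=; lia.
  case: (eqVneq j i') => [->|_] /=; by [rewrite (negPf i'J); lia | rewrite !add0n].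
- by rewrite /=; lia.
by rewrite /class_form big_cons /= !sfmulA.
Qed.

Lemma tnth_map_inj (I J : eqType) (h : I -> J) (l : seq I) :
  (forall j, (count_mem j (map h l) <= 1)%N) ->
  injective (fun i : 'I_(size l) => h (tnth (in_tuple l) i)).
Proof.
move=> c1 i i'; have x0 := tnth (in_tuple l) i.
have u : uniq (map h l).
  apply: count_mem_uniq => j; have := c1 j; rewrite -has_pred1 has_count.
  by case: (count_mem _ _) => [|[]].
rewrite !(tnth_nth x0) /= -!(nth_map x0 (h x0)) // => /eqP.
by rewrite nth_uniq ?size_map // => /eqP/val_inj.
Qed.

Lemma codom_tnth (I : finType) (l : seq I) (J : finType) (h : I -> J) :
  codom [ffun i : 'I_(size l) => h (tnth (in_tuple l) i)] =i map h l.
Proof.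
move=> j; apply/codomP/mapP => [[i ->]|[x /(tnthP (in_tuple l))[i ->] ->]].
  by exists (tnth (in_tuple l) i); rewrite ?ffunE // mem_tnth.
by exists i; rewrite ffunE.
Qed.

Lemma gen_Pset J lam s ell F : gen J lam s F -> (s <= ell)%N -> @Pset k m lam ell F.
Proof.
case/gen_class=> rs [S [T [z [cJ cS <- ->]]]] sl.
have inE0 (I : eqType) (l : seq I) x : (count_mem x l <= 1)%N -> (x \in l) = count_mem x l :> nat.
  by rewrite -has_pred1 has_count; case: (count_mem _ _) => [|[]].
have c1 j : (count_mem j (map fst rs) <= 1)%N by have := cJ j; case: (j \in J); lia.
have c2 j : (count_mem j (map snd rs) <= 1)%N by have := cJ j; case: (j \in J); lia.
set D := (_ + _ + _)%N.
have lr : (size rs < D.+1)%N by rewrite /D; lia.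
have ls : (s < D.+1)%N by rewrite /D; lia.
have lt : (#|T| < D.+1)%N by rewrite /D; lia.
(* The indices outside [J] form the set [U] of the partition. *)
have lu : (#|~: J| < m.+1)%N by rewrite ltnS -[leqRHS]card_ord max_card.
apply/existsP; exists (Ordinal lr); apply/existsP; exists (Ordinal ls).
apply/existsP; exists (Ordinal lt); apply/existsP; exists (Ordinal lu).
apply/and3P; split => //=.
apply/existsP; exists [ffun i => (tnth (in_tuple rs) i).1].
apply/existsP; exists [ffun i => (tnth (in_tuple rs) i).2].
apply/existsP; exists S; apply/existsP; exists T; apply/existsP; exists (~: J).
apply/existsP; exists (finfun z).
apply/and5P; split; last (apply/and3P; split); rewrite ?cS //.
- by apply/injectiveP => i i'; rewrite !ffunE; apply: tnth_map_inj.
- by apply/injectiveP => i i'; rewrite !ffunE; apply: tnth_map_inj.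
- apply/forallP => j; rewrite !codom_tnth !inE0 // cJ !inE.
  by case: (j \in J).
rewrite /class_form big_tnth.
have -> : \big[mul/one]_(i in T) sfvar k (i, finfun z i) = \big[mul/one]_(i in T) sfvar k (i, z i).
  by apply: eq_bigr => i _; rewrite ffunE.
apply/eqP; congr (mul _ _); congr (mul _ _).
by apply: eq_bigr => i _; rewrite !ffunE.
Qed.

End Algebra.

(* k = F_q with q = 2^t: a finite field of characteristic 2. *)
Theorem theorem4p5 (k : finFieldType) (Hchar : 2%N \in [pchar k])
  (m : nat) (Hm : (1 <= m)%N) (lambda ell : nat)
  (Hlam : (lambda <= 2 * m)%N)
  (Hell1 : (lambda - m <= ell)%N) (Hell2 : (ell <= lambda./2)%N) :
  \dim (Sspace k m lambda ell) =
    ('C(2 * m, lambda) - binomz (2 * m) (lambda%:Z - (2 * ell)%:Z - 2))%N.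
Proof.
have cT : #|[set: 'I_m]| = m by rewrite cardsT card_ord.
(* The truncated difference in [Hell1] still yields [lambda <= m + ell]. *)
have lt : (lambda <= (m + ell + 0).+1)%N by lia.
have up : (\dim (Sspace k m lambda ell) + binsub (2 * m) lambda (0 + 2 * ell + 2) <=
    binsub (2 * m) lambda 0)%N.
  apply: (kills_dim k m m setT) => //; apply: kills_span => f.
  rewrite mem_enum => /Pset_gen[J [s [gF sl]]].
  exact: gen_kills (subsetT _) gF sl.
have lo : (binsub (2 * m) lambda 0 <=
    \dim (Sspace k m lambda ell) + binsub (2 * m) lambda (0 + 2 * ell + 2))%N.
  apply: (gen_dim k m m setT) => // J d s F _ gF sl; rewrite addn0 => dl.
  by apply: memv_span; rewrite mem_enum; apply: gen_Pset sl; rewrite -dl; exact: gF.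
have -> : 'C(2 * m, lambda) = binsub (2 * m) lambda 0 by rewrite /binsub subn0.
(* The integer lower index is negative exactly when [lambda < 2 * ell + 2], and then both
   conventions give zero. *)
have -> : binomz (2 * m) (lambda%:Z - (2 * ell)%:Z - 2) =
          binsub (2 * m) lambda (0 + 2 * ell + 2).
  rewrite /binsub; case: leqP => le.
    have -> : (lambda%:Z - (2 * ell)%:Z - 2) = (lambda - (0 + 2 * ell + 2))%N%:Z by lia.
    by [].
  by case E: (lambda%:Z - (2 * ell)%:Z - 2) => [p|p] //; lia.
move: up lo; lia.
Qed.
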